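(* Let $M$ be a stochastic shortest path problem (undiscounted) such that there exists at least one proper policy and every improper policy $\mu$ satisfies $J^\mu(i)=\lim_{k\to\infty}\left[\sum_{t=0}^{k-1}P_\mu^t g_\mu\right]_i=\infty$ for some $i\in S$. For $p_\varepsilon\in(0,1)$ let $\hat M$ be the modified problem with transition probabilities $\hat P_{ij}(a)=(1-p_\varepsilon)P_{ij}(a)$ and $\hat P_{i0}(a)=P_{i0}(a)+p_\varepsilon\sum_{j=1}^nP_{ij}(a)$ for all $i,j\in S$, $a\in A$; let $\hat J^*$ be its optimal value and $\hat\mu^*$ a corresponding optimal policy for $\hat M$. Then for every $\varepsilon>0$ there exists $\delta>0$ such that, if $p_\varepsilon\in(0,\delta)$, then $\|\hat J^*-J^*\|\le\varepsilon$. Furthermore, if $\delta>0$ is sufficiently small, then $p_\varepsilon\in(0,\delta)$ implies that $\hat\mu^*$ is also an optimal policy for $M$.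
   Context: Stochastic shortest path problem $M=(S,A,P)$: $S=\{1,\dots,n\}$ is a finite state set, $A$ a finite action set, and $0$ is an additional terminal state. For each $a\in A$ there are transition probabilities $P_{ij}(a)\ge 0$ ($i,j\in S$) with $\sum_{j=1}^nP_{ij}(a)\le 1$ and $P_{i0}(a)=1-\sum_{j=1}^nP_{ij}(a)$; the terminal state is absorbing and cost free. $g:S\times A\to\mathbb{R}$ is the stage cost (the same for $M$ and $\hat M$). A policy is a function $\mu:S\to A$; $\Pi$ is the finite set of policies. $P_\mu=(P_{ij}(\mu(i)))_{i,j\in S}$, $g_\mu=(g(i,\mu(i)))_{i\in S}$. The cost-to-go of $\mu$ is the expected total cost $J^\mu(i)=\lim_{k\to\infty}\left[\sum_{t=0}^{k-1}P_\mu^tg_\mu\right]_i$ (possibly infinite), and $J^*(i)=\min_{\mu\in\Pi}J^\mu(i)$. A policy $\mu$ is optimal if $J^\mu=J^*$. A policy is proper if the terminal state is reached with probability 1 from any initial state, and improper otherwise. The same definitions with $\hat P$ in place of $P$ give the notions for $\hat M$. $\|\cdot\|$ is any norm on $\mathbb{R}^n$. *)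

(* Defs.v *)
From HB Require Import structures.
From mathcomp Require Import all_boot all_order all_algebra.
From mathcomp Require Import all_classical all_reals all_analysis.
Set Implicit Arguments.
Unset Strict Implicit.
Unset Printing Implicit Defensive.
Import Order.TTheory GRing.Theory Num.Theory.
Import numFieldNormedType.Exports.
Local Open Scope classical_set_scope.
Local Open Scope ring_scope.

(* Stochastic shortest path problems with non-terminal states 'I_n and finite
   action set A.  Only the substochastic part of the transition law is a field:
   the probability of moving to the terminal state is the missing mass
   [term_prob]. *)
Record ssp (R : realType) (n : nat) (A : finType) := SSP {
  trans : 'I_n -> A -> 'I_n -> R ;
  cost : 'I_n -> A -> R ;
  trans_ge0 : forall i a j, 0 <= trans i a j ;
  trans_sum_le1 : forall i a, \sum_j trans i a j <= 1
}.

Definition policy (n : nat) (A : finType) := {ffun 'I_n -> A}.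

Section SSP.
Context {R : realType} {n : nat} {A : finType}.
Implicit Types (M : ssp R n A) (mu : policy n A).

Definition term_prob M (i : 'I_n) (a : A) : R := 1 - \sum_j trans M i a j.

Definition trans_mx M mu : 'M[R]_n := \matrix_(i, j) trans M i (mu i) j.

Definition cost_vec M mu : 'cV[R]_n := \col_i cost M i (mu i).

Definition partial_cost M mu (k : nat) (i : 'I_n) : R :=
  (\sum_(0 <= t < k) trans_mx M mu ^+ t *m cost_vec M mu) i ord0.

(* [lim] returns 0 when the limit does not exist in the extended reals, so the
   value +oo is only taken by genuine divergence: see [cost_to_goyP]. *)
Definition cost_to_go M mu (i : 'I_n) : \bar R :=
  lim ((partial_cost M mu k i)%:E @[k --> \oo]).

Lemma cost_to_goyP M mu i :
  cost_to_go M mu i = +oo%E <->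
  (partial_cost M mu k i)%:E @[k --> \oo] --> +oo%E.
Proof.
split=> [|cvy]; last exact: cvg_lim cvy.
rewrite /cost_to_go => limy.
have [|ncv] := pselect (cvg ((partial_cost M mu k i)%:E @[k --> \oo])).
  by rewrite limy.
by move: limy; rewrite (dvgP ncv).
Qed.

(* +oo is neutral for the minimum, so this is the minimum over all policies as
   soon as there is one. *)
Definition opt_cost M (i : 'I_n) : \bar R :=
  \big[Order.min/+oo%E]_(mu : policy n A) cost_to_go M mu i.

(* Optimal cost as a vector of R^n; meaningful when all the entries of
   [opt_cost M] are finite. *)
Definition opt_vec M : 'cV[R]_n := \col_i fine (opt_cost M i).

Definition optimal_policy M mu : Prop := forall i, cost_to_go M mu i = opt_cost M i.

(* One-step law of the Markov chain of mu on S + {terminal state}; the terminal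
   state is None. *)
Definition chain_prob M mu (x y : option 'I_n) : R :=
  match x, y with
  | Some i, Some j => trans M i (mu i) j
  | Some i, None => term_prob M i (mu i)
  | None, Some _ => 0
  | None, None => 1
  end.

(* Probability that the chain started at x follows the trajectory s. *)
Fixpoint path_prob M mu (x : option 'I_n) (s : seq (option 'I_n)) : R :=
  if s is y :: s' then chain_prob M mu x y * path_prob M mu y s' else 1.

(* Probability that the chain started at x visits the terminal state at some
   time t <= k: total mass of the trajectories of length k doing so. *)
Definition reach_prob M mu (k : nat) (x : option 'I_n) : R :=
  \sum_(s : k.-tuple (option 'I_n) | None \in x :: s) path_prob M mu x s.

(* The events "terminal state visited by time k" increase with k to "terminal
   state reached", whose probability is thus the limit of [reach_prob]. *)
Definition proper_policy M mu : Prop :=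
  forall i : 'I_n, reach_prob M mu k (Some i) @[k --> \oo] --> (1 : R).

Definition improper_policy M mu : Prop := ~ proper_policy M mu.

Section Modified.
Variables (M : ssp R n A) (p : R) (p01 : 0 < p < 1).

Definition modified_trans (i : 'I_n) (a : A) (j : 'I_n) : R :=
  (1 - p) * trans M i a j.

Lemma modified_trans_ge0 i a j : 0 <= modified_trans i a j.
Proof.
case/andP: p01 => _ /ltW p1.
by rewrite mulr_ge0 ?subr_ge0 ?trans_ge0.
Qed.

Lemma modified_trans_sum_le1 i a : \sum_j modified_trans i a j <= 1.
Proof.
case/andP: p01 => /ltW p0 /ltW p1.
rewrite /modified_trans -mulr_sumr mulr_ile1 ?subr_ge0 ?trans_sum_le1 //.
  by rewrite sumr_ge0 // => j _; exact: trans_ge0.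
by rewrite gerBl.
Qed.

Definition modified : ssp R n A :=
  SSP (cost M) modified_trans_ge0 modified_trans_sum_le1.

Lemma modified_term_prob i a :
  term_prob modified i a = term_prob M i a + p * \sum_j trans M i a j.
Proof.
by rewrite /term_prob /= /modified_trans -mulr_sumr mulrBl mul1r opprB addrAC addrA.
Qed.

End Modified.

End SSP.

Definition is_norm (R : realType) (n : nat) (N : 'cV[R]_n -> R) : Prop :=
  [/\ forall x, N x = 0 -> x = 0,
      forall (c : R) x, N (c *: x) = `|c| * N x
    & forall x y, N (x + y) <= N x + N y].

(* Main.v *)
Require Import Defs.
From mathcomp Require Import all_boot all_order all_algebra.
From mathcomp Require Import all_classical all_reals all_analysis.
From mathcomp Require Import ring lra zify.
Import Order.TTheory GRing.Theory Num.Theory.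
Import numFieldNormedType.Exports.
Local Open Scope classical_set_scope.
Local Open Scope ring_scope.
Set Implicit Arguments.
Unset Strict Implicit.
Unset Printing Implicit Defensive.

(** The modified problem with parameter p is the discounted problem with
    factor 1 - p: its transition matrices are (1 - p) P_mu, so the cost of mu
    in it is the Abel sum of the series whose partial sums S_k define the cost
    of mu in M. By Abel's theorem this cost tends, as p decreases to 0, to the
    cost of mu in M ([discounted_cost_gt], [discounted_cost_lt]), provided that
    S_k(i) has a limit, finite or +oo, for each mu and i. As there are finitely
    many policies and states, both conclusions follow: the finite minima over
    policies converge, and for small p a strict inequality between the costs of
    two policies in M persists in the modified problem, so that a policy
    optimal there is optimal in M.

    That S_k(i) has a limit, and never -oo, is where the hypotheses enter
    ([partial_cost_has_limit]); they only assert divergence to +oo at some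
    state, while S_k(i) could a priori oscillate or tend to -oo at others. The
    powers of a substochastic matrix P are bounded, so ker (1 - P) and
    im (1 - P) are complementary and the stage cost is g = h + (w - P w) with
    P h = h ([ergodic_decomposition]). Hence S_k = k h + w - P^k w, and the sign
    of the drift h decides: S_k(i) tends to +oo if h(i) > 0 and is bounded above
    otherwise. Suppose min h <= 0. Then D = argmin h is closed for the chain of
    mu. Follow mu on D and a proper policy mu0 elsewhere. The maximum principle
    confines any positive drift of this spliced policy to a set which is closed
    and without termination for mu0, so there is none; by hypothesis the spliced
    policy is then proper ([splice_proper]). Therefore P^k v tends to 0 on D for
    every v; taking v = h gives min h = 0, and taking v = w gives the
    convergence of S_k on D. Off D the drift is positive. *)

(** * Substochastic matrices *)

Definition substochastic (R : realType) (n : nat) (P : 'M[R]_n) : Prop :=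
  (forall i j, 0 <= P i j) /\ (forall i, \sum_j P i j <= 1).

Definition powers_vanish (R : realType) (n : nat) (P : 'M[R]_n) : Prop :=
  forall (v : 'cV[R]_n) i, (P ^+ k *m v) i ord0 @[k --> \oo] --> (0 : R).

Section Substochastic.
Context {R : realType} {n : nat}.
Implicit Types (P : 'M[R]_n) (v w g h : 'cV[R]_n).

Lemma mulmx_powS P k v : P ^+ k.+1 *m v = P *m (P ^+ k *m v).
Proof. by rewrite exprS -mulmxE mulmxA. Qed.

Lemma mulmx_pow_fixed P h k : P *m h = h -> P ^+ k *m h = h.
Proof.
move=> Ph; elim: k => [|k IH]; first by rewrite expr0 mul1mx.
by rewrite mulmx_powS IH.
Qed.

Lemma entries_bounded v : exists2 b : R, 0 <= b & forall i, `|v i ord0| <= b.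
Proof.
exists (\sum_i `|v i ord0|) => [|i]; first exact: sumr_ge0.
by rewrite (bigD1 i) //= lerDl sumr_ge0.
Qed.

Lemma substochastic_bound P v (b : R) : substochastic P -> 0 <= b ->
  (forall i, `|v i ord0| <= b) -> forall i, `|(P *m v) i ord0| <= b.
Proof.
move=> [P0 P1] b0 vb i; rewrite mxE; apply: (le_trans (ler_norm_sum _ _ _)).
have: \sum_j P i j * b <= b.
  by rewrite -mulr_suml ler_piMl.
apply: le_trans; apply: ler_sum => j _.
by rewrite normrM (ger0_norm (P0 i j)) ler_wpM2l.
Qed.

Lemma substochastic_pow_bounded P v : substochastic P ->
  exists2 b : R, 0 <= b & forall k i, `|(P ^+ k *m v) i ord0| <= b.
Proof.
move=> Psub; have [b b0 vb] := entries_bounded v; exists b => //.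
elim=> [|k IH] i; first by rewrite expr0 mul1mx.
by rewrite mulmx_powS; apply: substochastic_bound.
Qed.

(** If u = (1 - P) v is fixed by P, then P^k v = v - k u, which is bounded in k
    only when u = 0. *)
Lemma ker_sqr_sub1 P v : substochastic P ->
  (1%:M - P) *m ((1%:M - P) *m v) = 0 -> (1%:M - P) *m v = 0.
Proof.
move=> Psub; set u := (1%:M - P) *m v => u0.
have Pu : P *m u = u.
  by apply/esym/eqP; rewrite -subr_eq0 -{1}(mul1mx u) -mulmxBl u0.
have Pv : P *m v = v - u by rewrite /u mulmxBl mul1mx opprB addrC subrK.
have Pkv k : P ^+ k *m v = v - u *+ k.
  elim: k => [|k IH]; first by rewrite expr0 mul1mx mulr0n subr0.
  rewrite mulmx_powS IH mulmxBr -scaler_nat -scalemxAr Pu Pv scaler_nat mulrS.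
  by rewrite opprD addrA.
have [b b0 Pb] := substochastic_pow_bounded v Psub.
apply/matrixP => i j; rewrite (ord1 j) [RHS]mxE; apply/eqP; apply: contraT => ui0.
have [k hk] : exists k : nat, (b + b) / `|u i ord0| < k%:R.
  by exists (Num.truncn ((b + b) / `|u i ord0|)).+1; exact: truncnS_gt.
have uk : `|u i ord0| *+ k <= b + b.
  rewrite -normrMn.
  have -> : u i ord0 *+ k = (P ^+ 0 *m v) i ord0 - (P ^+ k *m v) i ord0.
    have uE : u *+ k = P ^+ 0 *m v - P ^+ k *m v.
      by rewrite !Pkv mulr0n subr0 opprB addrCA subrr addr0.
    by rewrite -mulmxnE uE mxE [X in _ + X]mxE.
  by apply: (le_trans (ler_normB _ _)); apply: lerD.
move: hk; rewrite ltr_pdivrMr ?normr_gt0 // mulr_natl => hk.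
by move: (lt_le_trans hk uk); rewrite ltxx.
Qed.

(** As 1 - P and its square have the same kernel, they have the same rank, hence
    the same image: (1 - P) g = (1 - P)^2 w for some w, and h = g - (1 - P) w is
    fixed by P. *)
Lemma ergodic_decomposition P g : substochastic P ->
  exists h w, P *m h = h /\ g = h + (w - P *m w).
Proof.
move=> Psub.
(* Matrices act on row vectors in [kermx] and [submx], whence the transpose. *)
pose D := (1%:M - P)^T.
have kerD : (kermx (D *m D) <= kermx D)%MS.
  apply/rV_subP => u /sub_kermxP; rewrite mulmxA => uDD.
  apply/sub_kermxP; apply: trmx_inj; rewrite trmx0 trmx_mul trmxK.
  apply: ker_sqr_sub1 => //.
  by apply: trmx_inj; rewrite trmx0 !trmx_mul trmxK -/D uDD.
have rkD : (D <= D *m D)%MS.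
  rewrite -(mxrank_leqif_sup (submxMl D D)).
  apply/eqP/anti_leq; rewrite mxrankM_maxl /=.
  move/mxrankS: kerD; rewrite !mxrank_ker.
  have := rank_leq_row D; have := rank_leq_row (D *m D); move: (\rank D) (\rank (D *m D)) => a b; lia.
have [x Dx] := submxP (submx_trans (submxMl g^T D) rkD).
exists (g - (1%:M - P) *m x^T), x^T; split; last first.
  by rewrite mulmxBl mul1mx subrK.
have gx : (1%:M - P) *m g = (1%:M - P) *m ((1%:M - P) *m x^T).
  by apply: trmx_inj; rewrite !trmx_mul trmxK -/D Dx mulmxA.
apply/esym/eqP; rewrite -subr_eq0 -[X in X - _]mul1mx -mulmxBl.
by rewrite mulmxBr gx subrr.
Qed.

Lemma partial_sum_decomposition P g h w k i : P *m h = h ->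
  g = h + (w - P *m w) ->
  (\sum_(0 <= t < k) P ^+ t *m g) i ord0 =
    h i ord0 *+ k + w i ord0 - (P ^+ k *m w) i ord0.
Proof.
move=> Ph ->; suff -> : \sum_(0 <= t < k) P ^+ t *m (h + (w - P *m w)) =
    h *+ k + w - P ^+ k *m w by rewrite !mxE mulmxnE.
elim: k => [|k IH].
  by rewrite big_nil mulr0n add0r expr0 mul1mx subrr.
rewrite big_nat_recr //= IH mulmxDr mulmxBr (mulmx_pow_fixed _ Ph) mulmxA.
by rewrite mulmxE -exprSr addrCA subrKA mulrS !addrA.
Qed.

(** A vector fixed by P equals P^k h, which tends to 0; so there is no drift
    and w is the limit. *)
Lemma partial_sum_cvg P g : substochastic P -> powers_vanish P ->
  exists w, forall i, (\sum_(0 <= t < k) P ^+ t *m g) i ord0 @[k --> \oo] --> w i ord0.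
Proof.
move=> Psub Pv; have [h [w [Ph gE]]] := ergodic_decomposition g Psub.
have h0 i : h i ord0 = 0.
  have := Pv h i; under eq_fun do rewrite (mulmx_pow_fixed _ Ph).
  by move/cvg_lim => <- //; rewrite lim_cst.
exists w => i; under eq_fun do rewrite (partial_sum_decomposition _ _ Ph gE) h0.
under eq_fun do rewrite mul0rn add0r.
have := cvgB (cvg_cst (w i ord0)) (Pv w i); rewrite subr0; exact.
Qed.

Lemma partial_sum_cvgy P g h w i : substochastic P -> P *m h = h ->
  g = h + (w - P *m w) -> 0 < h i ord0 ->
  (\sum_(0 <= t < k) P ^+ t *m g) i ord0 @[k --> \oo] --> +oo.
Proof.
move=> Psub Ph gE hi; have [b b0 Pb] := substochastic_pow_bounded w Psub.
have {}Pb k : - b <= w i ord0 - (P ^+ k *m w) i ord0 + b.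
  rewrite -lerBlDr -opprD lerNl opprB.
  have := Pb k i; have := Pb 0%N i; rewrite expr0 mul1mx.
  by rewrite !ler_norml; lra.
apply/cvgryPge => a.
near=> k; rewrite (partial_sum_decomposition _ _ Ph gE).
suff : a + b + b <= h i ord0 *+ k by have := Pb k; lra.
rewrite -mulr_natr -ler_pdivrMl //.
near: k; exact: nbhs_infty_ger.
Unshelve. all: by end_near. Qed.

Lemma partial_sum_bounded_above P g h w i : substochastic P -> P *m h = h ->
  g = h + (w - P *m w) -> h i ord0 <= 0 ->
  exists b, forall k, (\sum_(0 <= t < k) P ^+ t *m g) i ord0 <= b.
Proof.
move=> Psub Ph gE hi; have [b b0 Pb] := substochastic_pow_bounded w Psub.
exists (w i ord0 + b) => k; rewrite (partial_sum_decomposition _ _ Ph gE).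
have := Pb k i; rewrite ler_norml => /andP[bk _].
have : h i ord0 *+ k <= 0 by rewrite mulrn_wle0.
by move: bk; lra.
Qed.

Definition closed_under P (D : pred 'I_n) : Prop :=
  forall i j, D i -> ~~ D j -> P i j = 0.

(** Maximum principle. At a minimizer i, the average under row i of the
    nonnegative function h - m is m (1 - sum of row i) <= 0, so row i charges
    only minimizers. Applied to - h it says that the states where h attains a
    nonnegative maximum form a closed set. *)
Lemma argmin_closed P h (m : R) : substochastic P -> P *m h = h ->
  (forall i, m <= h i ord0) -> m <= 0 ->
  closed_under P [pred i | h i ord0 == m].
Proof.
move=> [P0 P1] Ph mh m0 i j /eqP hi /negbTE /= hj.
have terms_ge0 l : true -> 0 <= P i l * (h l ord0 - m).
  by move=> _; rewrite mulr_ge0 ?subr_ge0.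
have : \sum_l P i l * (h l ord0 - m) = 0.
  apply/le_anti; rewrite (sumr_ge0 _ terms_ge0) andbT.
  under eq_bigr do rewrite mulrBr; rewrite sumrB -mulr_suml.
  have -> : \sum_l P i l * h l ord0 = m by rewrite -hi -{2}Ph mxE.
  by have := P1 i; nra.
move/eqP; rewrite psumr_eq0 // => /allP /(_ j (mem_index_enum _)) /=.
by rewrite mulf_eq0 subr_eq0 hj orbF => /eqP.
Qed.

(** No mass can be lost at a maximizer of h: the average of h under that row is
    at most the row sum times m, and it must reach m > 0. *)
Lemma argmax_stochastic P h (m : R) : substochastic P -> P *m h = h ->
  (forall i, h i ord0 <= m) -> 0 < m ->
  forall i, h i ord0 = m -> \sum_j P i j = 1.
Proof.
move=> [P0 P1] Ph hm m0 i hi; apply/le_anti; rewrite P1 /=.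
have : m <= (\sum_j P i j) * m.
  rewrite -{1}hi -Ph mxE mulr_suml; apply: ler_sum => j _.
  exact: ler_wpM2l.
by rewrite -{1}[m]mul1r ler_pM2r.
Qed.

Lemma closed_pow_agree P P' (D : pred 'I_n) v v' : closed_under P D ->
  (forall i j, D i -> P' i j = P i j) -> (forall i, D i -> v' i ord0 = v i ord0) ->
  forall k i, D i -> (P' ^+ k *m v') i ord0 = (P ^+ k *m v) i ord0.
Proof.
move=> DP PP' vv'; elim=> [|k IH] i Di; first by rewrite !expr0 !mul1mx vv'.
rewrite !mulmx_powS !mxE; apply: eq_bigr => j _; rewrite PP' //.
by have [/IH -> //|Dj] := boolP (D j); rewrite (DP i j) // !mul0r.
Qed.

(** The chain never terminates from a closed set of stochastic rows: P^k 1
    equals 1 there. *)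
Lemma closed_stochastic_empty P (D : pred 'I_n) : substochastic P ->
  powers_vanish P -> closed_under P D ->
  (forall i, D i -> \sum_j P i j = 1) -> forall i, ~~ D i.
Proof.
move=> Psub Pv DP D1 i; apply/negP => Di.
have Pk k l : D l -> (P ^+ k *m (const_mx 1 : 'cV_n)) l ord0 = 1.
  elim: k l => [|k IH] l Dl; first by rewrite expr0 mul1mx mxE.
  rewrite mulmx_powS mxE -[RHS](D1 l Dl); apply: eq_bigr => j _.
  by have [/IH -> |Dj] := boolP (D j); rewrite ?mulr1 // (DP l j) // mul0r.
have := Pv (const_mx 1) i; under eq_fun do rewrite Pk //.
by move/cvg_lim; rewrite lim_cst // => /(_ (@Rhausdorff R)) /eqP; rewrite oner_eq0.
Qed.

End Substochastic.

(** * Finite sums over options and tuples *)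

Lemma sum_option (V : nmodType) (T : finType) (F : option T -> V) :
  \sum_y F y = F None + \sum_j F (Some j).
Proof.
rewrite (bigD1 None) //=; congr (_ + _).
rewrite (reindex_omap Some id) => [|[j|]] //=.
by apply: eq_bigl => j; rewrite eqxx.
Qed.

Lemma sum_tupleS (V : nmodType) (T : finType) k (Q : pred (seq T)) (F : seq T -> V) :
  \sum_(s : k.+1.-tuple T | Q s) F s =
  \sum_y \sum_(s : k.-tuple T | Q (y :: s)) F (y :: s).
Proof.
rewrite pair_big_dep /= (reindex (fun p : T * k.-tuple T => cons_tuple p.1 p.2)) //=.
exists (fun s => (thead s, [tuple of behead s])) => [[x s] _|s _] /=.
  by congr pair; apply: val_inj.
by rewrite [RHS]tuple_eta; apply: val_inj.
Qed.

(** * Abel summation *)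

Section Abel.
Context {R : realType}.
Implicit Types (c : nat -> R) (a b q : R).

Let psum c k := \sum_(0 <= t < k) c t.

(** Summation by parts, centred at a reference value a: the weights (1 - q) q^t
    and q^m add up to 1, so an Abel sum is an average of partial sums. *)
Lemma discounted_sum_by_parts c a q m :
  \sum_(0 <= t < m) q ^+ t * c t =
  a + (1 - q) * \sum_(0 <= t < m) q ^+ t * (psum c t.+1 - a) + q ^+ m * (psum c m - a).
Proof.
rewrite /psum; elim: m => [|m IH].
  by rewrite !big_nil expr0; ring.
rewrite [LHS]big_nat_recr //= IH.
rewrite [in RHS]big_nat_recr //= exprS.
by rewrite (@big_nat_recr _ _ _ m) //=; ring.
Qed.

(** Only the finitely many partial sums below a pull the average below a, and
    they carry weight O(1 - q). *)
Lemma discounted_sum_ge c a : (\forall k \near \oo, a <= psum c k) ->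
  exists C, forall q, 0 < q < 1 ->
    \forall m \near \oo, a - (1 - q) * C <= \sum_(0 <= t < m) q ^+ t * c t.
Proof.
case=> K _ aS; exists (\sum_(0 <= t < K) `|psum c t.+1 - a|) => q /andP[q0 q1].
exists K => // m /= Km; rewrite (discounted_sum_by_parts _ a).
have Sm : 0 <= q ^+ m * (psum c m - a).
  by rewrite mulr_ge0 ?exprn_ge0 ?subr_ge0 ?(ltW q0) ?aS.
rewrite -addrA lerD2l -mulrN; apply: ler_wpDr => //.
rewrite ler_wpM2l ?subr_ge0 ?(ltW q1) // (big_cat_nat (leq0n K) Km) /=.
apply: ler_wpDr.
  rewrite big_seq_cond sumr_ge0 // => t.
  rewrite andbT mem_index_iota => /andP[Kt _].
  by rewrite mulr_ge0 ?exprn_ge0 ?subr_ge0 ?(ltW q0) ?aS //= leqW.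
rewrite -sumrN; apply: ler_sum => t _.
apply: lerNnormlW; rewrite normrM.
by rewrite ler_piMl // normrX exprn_ile1 // ger0_norm ?ltW.
Qed.

Section Limit.
Variables (c : nat -> R) (F : R -> R).
Hypothesis cF : forall p, 0 < p < 1 ->
  \sum_(0 <= t < m) (1 - p) ^+ t * c t @[m --> \oo] --> F p.

(** Half of Abel's theorem, with one-sided hypothesis and conclusion: it serves
    both finite limits and the limit +oo. *)
Lemma abel_gt a b : (\forall k \near \oo, a <= psum c k) -> b < a ->
  \forall p \near 0^'+, b < F p.
Proof.
move=> /discounted_sum_ge [C HC] ba.
have C1 : 0 < `|C| + 1 by rewrite ltr_wpDl.
have abC : 0 < (a - b) / (`|C| + 1) by rewrite divr_gt0 ?subr_gt0.
near=> p.
have p01 : 0 < p < 1 by apply/andP; split; near: p; [exact: nbhs_right_gt|exact: nbhs_right_lt].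
have : a - p * C <= F p.
  rewrite -(cvg_lim _ (cF p01)) //; apply: limr_ge; first by apply: cvgP (cF p01).
  have q01 : 0 < 1 - p < 1 by lra.
  by have := HC _ q01; rewrite subKr.
apply: lt_le_trans.
suff : p * C < a - b by lra.
have : p < (a - b) / (`|C| + 1) by near: p; exact: nbhs_right_lt.
rewrite ltr_pdivlMr //; apply: le_lt_trans.
by rewrite ler_wpM2l // (le_trans (ler_norm _)) // lerDl.
Unshelve. all: by end_near. Qed.
End Limit.

Lemma abel_lt c (F : R -> R) a b :
  (forall p, 0 < p < 1 ->
    \sum_(0 <= t < m) (1 - p) ^+ t * c t @[m --> \oo] --> F p) ->
  (\forall k \near \oo, psum c k <= a) -> a < b ->
  \forall p \near 0^'+, F p < b.
Proof.
move=> cF cb ab.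
have : \forall p \near 0^'+, - b < - F p.
  apply: (@abel_gt (fun t => - c t) (fun p => - F p) _ (- a)).
  - move=> p p01; under eq_fun do under eq_bigr do rewrite mulrN.
    by under eq_fun do rewrite sumrN; apply: cvgN; exact: cF.
  - by apply: filterS cb => k; rewrite /psum sumrN lerN2.
  - by rewrite ltrN2.
by apply: filterS => p; rewrite ltrN2.
Qed.

End Abel.

(** * Trajectories and proper policies *)

Section ProperPolicies.
Context {R : realType} {n : nat} {A : finType}.
Implicit Types (M : ssp R n A) (mu : policy n A).

Lemma trans_mx_substochastic M mu : substochastic (trans_mx M mu).
Proof.
split=> [i j|i]; first by rewrite mxE trans_ge0.
by under eq_bigr do rewrite mxE; exact: trans_sum_le1.
Qed.

Lemma path_prob_total M mu k x :
  \sum_(s : k.-tuple (option 'I_n)) path_prob M mu x s = 1.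
Proof.
elim: k x => [|k IH] x.
  rewrite (big_pred1 [tuple]) // => s; exact/esym/eqP/tuple0.
rewrite (sum_tupleS _ predT) /=.
under eq_bigr do rewrite -mulr_sumr IH mulr1.
rewrite sum_option; case: x => [i|] /=; last by rewrite big1 ?addr0.
by rewrite /term_prob subrK.
Qed.

Lemma path_prob_survive M mu k i :
  \sum_(s : k.-tuple (option 'I_n) | None \notin Some i :: s) path_prob M mu (Some i) s
  = (trans_mx M mu ^+ k *m (const_mx 1 : 'cV_n)) i ord0.
Proof.
elim: k i => [|k IH] i.
  rewrite expr0 mul1mx mxE (big_pred1 [tuple]) // => s.
  by rewrite [s]tuple0 [RHS]eqxx.
rewrite (sum_tupleS _ (fun s => None \notin Some i :: s)) sum_option.
rewrite big1 => [|s]; last by rewrite !inE.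
rewrite add0r mulmx_powS mxE; apply: eq_bigr => j _.
rewrite -IH mulr_sumr [trans_mx _ _ _ _]mxE; apply: eq_bigl => s.
by rewrite !inE.
Qed.

(** The probability of not having terminated by time k is (P^k 1)(i), and P^k v
    is dominated by a multiple of P^k 1. *)
Lemma proper_powers_vanish M mu : proper_policy M mu -> powers_vanish (trans_mx M mu).
Proof.
move=> prop v i; set P := trans_mx M mu; pose u : 'cV[R]_n := const_mx 1.
have Pu0 : (P ^+ k *m u) i ord0 @[k --> \oo] --> (0 : R).
  have reachE k : (P ^+ k *m u) i ord0 = 1 - reach_prob M mu k (Some i).
    rewrite -path_prob_survive -(path_prob_total M mu k (Some i)).
    rewrite [X in X - _](bigID (fun s : k.-tuple _ => None \in Some i :: s)) /=.
    by rewrite /reach_prob addrAC subrr add0r.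
  under eq_fun do rewrite reachE.
  have := cvgB (cvg_cst (1 : R)) (prop i); rewrite subrr; exact.
have [b b0 vb] := entries_bounded v.
have Pv k : `|(P ^+ k *m v) i ord0| <= b * (P ^+ k *m u) i ord0.
  elim: k i {Pu0} => [|k IH] i; first by rewrite expr0 !mul1mx [u _ _]mxE mulr1.
  rewrite !mulmx_powS [X in `|X|]mxE [X in _ * X]mxE mulr_sumr.
  apply: (le_trans (ler_norm_sum _ _ _)); apply: ler_sum => j _.
  have P0 : 0 <= P i j by have [P0 _] := trans_mx_substochastic M mu.
  by rewrite normrM (ger0_norm P0) mulrCA ler_wpM2l.
have bPu0 : b * (P ^+ k *m u) i ord0 @[k --> \oo] --> (0 : R).
  have := cvgM (cvg_cst b) Pu0; rewrite mulr0; exact.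
apply/norm_cvg0P; apply: squeeze_cvgr bPu0; last exact: (cvg_cst 0).
by near=> k; rewrite normr_ge0 Pv.
Unshelve. all: by end_near. Qed.
End ProperPolicies.

(** * Convergence of the partial costs *)

Section Policies.
Context {R : realType} {n : nat} {A : finType}.
Implicit Types (M : ssp R n A) (mu : policy n A).

Definition splice (D : pred 'I_n) mu mu0 : policy n A :=
  [ffun i => if D i then mu i else mu0 i].

Lemma splice_pow M mu mu0 (D : pred 'I_n) (v v' : 'cV[R]_n) k i :
  closed_under (trans_mx M mu) D -> (forall i, D i -> v' i ord0 = v i ord0) ->
  D i -> (trans_mx M (splice D mu mu0) ^+ k *m v') i ord0 =
         (trans_mx M mu ^+ k *m v) i ord0.
Proof.
move=> DP vv' Di; apply: closed_pow_agree Di => // l j Dl.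
by rewrite !mxE ffunE Dl.
Qed.

Lemma partial_costE M mu k i :
  partial_cost M mu k i =
  \sum_(0 <= t < k) (trans_mx M mu ^+ t *m cost_vec M mu) i ord0.
Proof. by rewrite /partial_cost summxE. Qed.

Lemma splice_partial_cost M mu mu0 (D : pred 'I_n) k i :
  closed_under (trans_mx M mu) D -> D i ->
  partial_cost M (splice D mu mu0) k i = partial_cost M mu k i.
Proof.
move=> DP Di; rewrite !partial_costE; apply: eq_bigr => t _.
by apply: splice_pow => // j Dj; rewrite !mxE ffunE Dj.
Qed.

(** If the spliced policy were improper, its cost would be +oo somewhere, so its
    drift h would have a positive maximum. On D the drift is nonpositive, the
    partial costs being bounded above; so the maximizers lie outside D, where
    the policy is mu0. By the maximum principle they form a closed set without
    termination, which a proper policy does not have. *)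
Lemma splice_proper M mu mu0 (D : pred 'I_n) : proper_policy M mu0 ->
  (improper_policy M (splice D mu mu0) ->
     exists i, cost_to_go M (splice D mu mu0) i = +oo%E) ->
  closed_under (trans_mx M mu) D ->
  (forall i, D i -> exists b, forall k, partial_cost M mu k i <= b) ->
  proper_policy M (splice D mu mu0).
Proof.
set mu' := splice D mu mu0 => prop0 imp' DP Dbnd; apply: contrapT => /imp'[i].
move/cost_to_goyP/cvgeryP => Siy.
have Psub := trans_mx_substochastic M mu'; set P := trans_mx M mu' in Psub.
have [h [w [Ph gE]]] := ergodic_decomposition (cost_vec M mu') Psub.
have bndy j b : partial_cost M mu' k j @[k --> \oo] --> +oo ->
    ~ forall k, partial_cost M mu' k j <= b.
  move=> /cvgryPge /(_ (b + 1)) [K _ /(_ K (leqnn K))] /= bS Sb.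
  by have := le_trans bS (Sb K); rewrite gerDl ler10.
have hi : 0 < h i ord0.
  rewrite ltNge; apply/negP => hi.
  have [b Sb] := partial_sum_bounded_above Psub Ph gE hi.
  exact: bndy Siy Sb.
have hD j : D j -> h j ord0 <= 0.
  move=> Dj; rewrite leNgt; apply/negP => hj; have [b Sb] := Dbnd _ Dj.
  apply: (bndy j b (partial_sum_cvgy Psub Ph gE hj)) => k.
  by rewrite splice_partial_cost.
have [i0 _ hmax] := @arg_maxP _ _ _ i predT (fun j => h j ord0) isT.
set m := h i0 ord0 in hmax; pose D' := [pred j | h j ord0 == m].
have {}hmax j : h j ord0 <= m by apply: hmax.
have m0 : 0 < m by apply: lt_le_trans hi _.
have D'P j : D' j -> forall l, trans_mx M mu0 j l = P j l.
  move=> /eqP hj l; have Dj : ~~ D j.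
    by apply/negP => /hD; rewrite hj leNgt m0.
  by rewrite !mxE ffunE (negbTE Dj).
suff : ~~ D' i0 by rewrite /= eqxx.
have D'closed : closed_under (trans_mx M mu0) D'.
  move=> j l D'j D'l; rewrite D'P //.
  have Nh : P *m (- h) = - h by rewrite mulmxN Ph.
  apply: (argmin_closed Psub Nh (m := - m)) => [q||/=|/=].
  - by rewrite mxE lerN2.
  - by rewrite oppr_le0 ltW.
  - by rewrite mxE eqr_opp.
  - by rewrite mxE eqr_opp.
apply: (closed_stochastic_empty (trans_mx_substochastic M mu0) _ D'closed).
  exact: proper_powers_vanish.
move=> j D'j; under eq_bigr do rewrite D'P //.
by apply: (argmax_stochastic Psub Ph hmax) => //; apply/eqP.
Qed.

(** Since [lim] has a default value on divergent sequences, this property is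
    what gives [cost_to_go] its meaning; it excludes the limit -oo too. *)
Definition partial_cost_limit M mu i : Prop :=
  (exists l : R, partial_cost M mu k i @[k --> \oo] --> l) \/
  (partial_cost M mu k i @[k --> \oo] --> +oo).

(** When the least drift m is nonpositive, splicing at D = argmin h makes the
    powers of P vanish on D. Applied to h this forces m = 0; applied to w it
    yields the limit on D, where the partial costs are w - P^k w. *)
Lemma partial_cost_has_limit M mu mu0 i : proper_policy M mu0 ->
  (forall mu, improper_policy M mu -> exists i, cost_to_go M mu i = +oo%E) ->
  partial_cost_limit M mu i.
Proof.
move=> prop0 imp; have Psub := trans_mx_substochastic M mu.
set P := trans_mx M mu in Psub.
have [h [w [Ph gE]]] := ergodic_decomposition (cost_vec M mu) Psub.
have [/(partial_sum_cvgy Psub Ph gE)|hi] := ltP 0 (h i ord0); first by right.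
left; have [i0 _ hmin] := @arg_minP _ _ _ i predT (fun j => h j ord0) isT.
set m := h i0 ord0 in hmin; pose D := [pred j | h j ord0 == m].
have {}hmin j : m <= h j ord0 by apply: hmin.
have m0 : m <= 0 by apply: le_trans hi.
have DP : closed_under P D by apply: argmin_closed.
have prop' : proper_policy M (splice D mu mu0).
  apply: (splice_proper prop0 (imp _) DP) => j /eqP hj.
  by apply: (partial_sum_bounded_above Psub Ph gE); rewrite hj.
have vanD j (v : 'cV_n) : D j -> (P ^+ k *m v) j ord0 @[k --> \oo] --> (0 : R).
  move=> Dj; have := proper_powers_vanish prop' v j.
  by under eq_fun do rewrite (@splice_pow _ _ _ _ v) //.
have mE : m = 0.
  have := vanD i0 h (eqxx _); under eq_fun do rewrite (mulmx_pow_fixed _ Ph).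
  by move/cvg_lim; rewrite lim_cst // => /(_ (@Rhausdorff R)).
have hi0 : h i ord0 = 0 by apply/le_anti; rewrite hi -mE hmin.
exists (w i ord0); rewrite /partial_cost.
under eq_fun do rewrite (partial_sum_decomposition _ _ Ph gE) hi0 mul0rn add0r.
have Di : D i by rewrite /= hi0 mE.
by have := cvgB (cvg_cst (w i ord0)) (vanD i w Di); rewrite subr0; exact.
Qed.

Lemma proper_cost_cvg M mu i : proper_policy M mu ->
  exists l : R, partial_cost M mu k i @[k --> \oo] --> l.
Proof.
move=> /proper_powers_vanish van.
have [w Sw] := partial_sum_cvg (cost_vec M mu) (trans_mx_substochastic M mu) van.
by exists (w i ord0); exact: Sw.
Qed.

Lemma cost_to_go_fin M mu i (l : R) :
  partial_cost M mu k i @[k --> \oo] --> l -> cost_to_go M mu i = l%:E.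
Proof.
move=> Sl; apply: (@cvg_lim _ (@ereal_hausdorff R)).
by apply: cvg_EFin => //; exact: nearW.
Qed.

(** * The modified problem as a discounted problem *)

(** Depends on p alone, whereas [modified M hp] needs a proof hp; this allows
    limits as p tends to 0. *)
Definition discounted_cost M mu (p : R) i : R :=
  lim (\sum_(0 <= t < m) (1 - p) ^+ t *
         (trans_mx M mu ^+ t *m cost_vec M mu) i ord0 @[m --> \oo]).

Lemma scale_mx_pow (q : R) (P : 'M[R]_n) k (v : 'cV[R]_n) i :
  ((q *: P) ^+ k *m v) i ord0 = q ^+ k * (P ^+ k *m v) i ord0.
Proof.
suff -> : (q *: P) ^+ k *m v = q ^+ k *: (P ^+ k *m v) by rewrite mxE.
elim: k => [|k IH]; first by rewrite !expr0 scale1r.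
by rewrite !mulmx_powS IH -scalemxAl -scalemxAr scalerA -exprS.
Qed.

Lemma trans_mx_modified M (p : R) (hp : 0 < p < 1) mu :
  trans_mx (modified M hp) mu = (1 - p) *: trans_mx M mu.
Proof. by apply/matrixP => i j; rewrite !mxE. Qed.

Lemma partial_cost_modified M (p : R) (hp : 0 < p < 1) mu k i :
  partial_cost (modified M hp) mu k i =
  \sum_(0 <= t < k) (1 - p) ^+ t * (trans_mx M mu ^+ t *m cost_vec M mu) i ord0.
Proof.
rewrite partial_costE; apply: eq_bigr => t _.
by rewrite trans_mx_modified scale_mx_pow.
Qed.

Lemma discounted_cost_cvg M mu (p : R) i : 0 < p < 1 ->
  \sum_(0 <= t < m) (1 - p) ^+ t * (trans_mx M mu ^+ t *m cost_vec M mu) i ord0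
    @[m --> \oo] --> discounted_cost M mu p i.
Proof.
move=> hp; have van : powers_vanish (trans_mx (modified M hp) mu).
  move=> v j; rewrite trans_mx_modified; under eq_fun do rewrite scale_mx_pow.
  have [b b0 Pb] := substochastic_pow_bounded v (trans_mx_substochastic M mu).
  have q1 : `|1 - p| < 1 by rewrite ger0_norm; lra.
  apply/norm_cvg0P; apply: squeeze_cvgr (cvg_geometric b q1); last exact: (cvg_cst 0).
  near=> k; rewrite normr_ge0 /= /geometric /= normrM mulrC.
  rewrite [`|(1 - p) ^+ k|]ger0_norm ?exprn_ge0 //; last by lra.
  by rewrite ler_wpM2r ?exprn_ge0 //; lra.
have [w Sw] := partial_sum_cvg (cost_vec (modified M hp) mu)
  (trans_mx_substochastic _ mu) van.
have Si : partial_cost (modified M hp) mu k i @[k --> \oo] --> w i ord0 by exact: Sw.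
rewrite /discounted_cost; under eq_fun do rewrite -(partial_cost_modified M hp).
exact: cvgP Si.
Unshelve. all: by end_near. Qed.

Lemma cost_to_go_modified M (p : R) (hp : 0 < p < 1) mu i :
  cost_to_go (modified M hp) mu i = (discounted_cost M mu p i)%:E.
Proof.
apply: cost_to_go_fin; under eq_fun do rewrite partial_cost_modified.
exact: discounted_cost_cvg.
Qed.

End Policies.

(** * Vanishing discount *)

Section VanishingDiscount.
Context {R : realType} {n : nat} {A : finType}.
Implicit Types (M : ssp R n A) (mu : policy n A).

Lemma cost_to_go_y M mu i :
  partial_cost M mu k i @[k --> \oo] --> +oo -> cost_to_go M mu i = +oo%E.
Proof. by move=> Sy; apply/cost_to_goyP/cvgeryP. Qed.

Lemma discounted_cost_gt M mu i (a : R) :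
  partial_cost_limit M mu i ->
  (a%:E < cost_to_go M mu i)%E ->
  \forall p \near 0^'+, a < discounted_cost M mu p i.
Proof.
move=> Scvg aJ.
suff [a' aa' Sa'] : exists2 a', a < a' & \forall k \near \oo, a' <= partial_cost M mu k i.
  apply: (abel_gt (F := fun p => discounted_cost M mu p i) (fun p => @discounted_cost_cvg _ _ _ M mu p i) _ aa').
  by apply: filterS Sa' => k; rewrite partial_costE.
case: Scvg aJ => [[l Sl]|Sy] aJ; last first.
  by exists (a + 1); [rewrite ltrDl | move/cvgryPge: Sy; exact].
move: aJ; rewrite (cost_to_go_fin Sl) lte_fin => al.
exists ((a + l) / 2); first by lra.
by apply: (cvgr_ge l Sl); lra.
Qed.

Lemma discounted_cost_lt M mu i (b : R) :
  partial_cost_limit M mu i ->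
  (cost_to_go M mu i < b%:E)%E ->
  \forall p \near 0^'+, discounted_cost M mu p i < b.
Proof.
move=> [[l Sl]|/cost_to_go_y ->]; last by rewrite ltNge leey.
rewrite (cost_to_go_fin Sl) lte_fin => lb.
apply: (abel_lt (F := fun p => discounted_cost M mu p i) (fun p => @discounted_cost_cvg _ _ _ M mu p i) (a := (l + b) / 2));
  last by lra.
have : \forall k \near \oo, partial_cost M mu k i <= (l + b) / 2.
  by apply: (cvgr_le l Sl); lra.
by apply: filterS => k; rewrite partial_costE.
Qed.

Lemma opt_cost_le M mu i : (opt_cost M i <= cost_to_go M mu i)%E.
Proof. exact: bigmin_le. Qed.

Lemma opt_cost_attained M (mu0 : policy n A) i :
  exists mu, opt_cost M i = cost_to_go M mu i.
Proof.
by rewrite /opt_cost (bigmin_eq_arg _ mu0) //= => [|mu _]; [eexists | exact: leey].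
Qed.

Lemma opt_cost_modified_fin M (mu0 : policy n A) (p : R) (hp : 0 < p < 1) i :
  opt_cost (modified M hp) i \is a fin_num.
Proof.
by have [mu ->] := opt_cost_attained (modified M hp) mu0 i; rewrite cost_to_go_modified.
Qed.

Section OptimalCosts.
Variables (M : ssp R n A) (mu0 : policy n A).
Hypothesis prop0 : proper_policy M mu0.
Hypothesis imp : forall mu, improper_policy M mu ->
  exists i, cost_to_go M mu i = +oo%E.

Let haslim mu i := partial_cost_has_limit mu i prop0 imp.

Lemma opt_cost_fin i : opt_cost M i \is a fin_num.
Proof.
have [mu JE] := opt_cost_attained M mu0 i.
have := opt_cost_le M mu0 i; have [l /cost_to_go_fin ->] := proper_cost_cvg i prop0.
rewrite JE; have [[r /cost_to_go_fin -> //]|/cost_to_go_y ->] := haslim mu i.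
by rewrite leNgt ltry.
Qed.

(** From above, the modified optimal cost is at most that of a fixed optimal
    choice mu for M at i; from below, the costs of all the policies are
    eventually larger than J - e. *)
Lemma opt_vec_modified_near i (e : R) : 0 < e ->
  \forall p \near 0^'+, forall hp : 0 < p < 1,
    `|(opt_vec (modified M hp) - opt_vec M) i ord0| <= e.
Proof.
move=> e0; have [mu JE] := opt_cost_attained M mu0 i.
pose J := fine (opt_cost M i).
have JJ : opt_cost M i = J%:E by rewrite fineK // opt_cost_fin.
near=> p => hp.
have [muh HE] := opt_cost_attained (modified M hp) mu0 i.
rewrite !mxE -/J HE cost_to_go_modified /= ler_norml.
have up : discounted_cost M mu p i < J + e.
  by near: p; apply: discounted_cost_lt => //; rewrite -JE JJ lte_fin ltrDl.
have low : forall nu, J - e < discounted_cost M nu p i.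
  near: p; apply: filter_forall => nu; apply: discounted_cost_gt => //.
  by apply: lt_le_trans (opt_cost_le M nu i); rewrite JJ lte_fin gtrBl.
have : discounted_cost M muh p i <= discounted_cost M mu p i.
  by rewrite -lee_fin -!(cost_to_go_modified M hp) -HE opt_cost_le.
by have := low muh; lra.
Unshelve. all: by end_near. Qed.

(** For small p, the strict inequalities between the costs in M of two policies
    at a state, finite in number, all persist in the modified problem. A policy
    beaten in M at some state is thus beaten in the modified problem. *)
Lemma optimal_modified_near :
  \forall p \near 0^'+, forall (hp : 0 < p < 1) muh,
    optimal_policy (modified M hp) muh -> optimal_policy M muh.
Proof.
have sep (x : policy n A * policy n A * 'I_n) :
  \forall p \near 0^'+, (cost_to_go M x.1.1 x.2 < cost_to_go M x.1.2 x.2)%E ->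
    discounted_cost M x.1.1 p x.2 < discounted_cost M x.1.2 p x.2.
  case: x => [[mu nu] i] /=.
  have [lt|_] := boolP (cost_to_go M mu i < cost_to_go M nu i)%E; last exact: nearW.
  have [a [mua anu]] : exists a : R,
      (cost_to_go M mu i < a%:E)%E /\ (a%:E < cost_to_go M nu i)%E.
    move: lt; have [[l /cost_to_go_fin ->]|/cost_to_go_y ->] := haslim mu i;
      last by rewrite ltNge leey.
    have [[r /cost_to_go_fin ->]|/cost_to_go_y -> _] := haslim nu i.
      by rewrite lte_fin => lr; exists ((l + r) / 2); rewrite !lte_fin; split; lra.
    by exists (l + 1); rewrite lte_fin ltrDl ltry.
  have := discounted_cost_lt (haslim mu i) mua.
  have := discounted_cost_gt (haslim nu i) anu.
  by apply: filterS2 => p a_lt lt_a _; exact: lt_trans lt_a a_lt.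
near=> p => hp muh opt i.
have sep_p : forall x : policy n A * policy n A * 'I_n,
    (cost_to_go M x.1.1 x.2 < cost_to_go M x.1.2 x.2)%E ->
    discounted_cost M x.1.1 p x.2 < discounted_cost M x.1.2 p x.2.
  by near: p; apply: filter_forall => x; exact: sep.
apply/le_anti; rewrite opt_cost_le andbT.
have [mu ->] := opt_cost_attained M mu0 i.
rewrite leNgt; apply/negP => /(sep_p (mu, muh, i)) /=.
by rewrite -lte_fin -!(cost_to_go_modified M hp) opt ltNge opt_cost_le.
Unshelve. all: by end_near. Qed.

End OptimalCosts.
End VanishingDiscount.

(** * Assembling the result *)

Lemma near_right0 (R : realType) (Q : R -> Prop) :
  (\forall p \near 0^'+, Q p) ->
  exists2 delta, 0 < delta & forall p, 0 < p < delta -> Q p.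
Proof.
case=> d /= d0 dQ; exists d => // p /andP[p0 pd]; apply: dQ => //=.
by rewrite sub0r normrN gtr0_norm.
Qed.

Lemma is_norm_bound (R : realType) (n : nat) (N : 'cV[R]_n -> R) : is_norm N ->
  exists2 C : R, 0 < C & forall (x : 'cV[R]_n) (e : R), 0 <= e ->
    (forall i, `|x i ord0| <= e) -> N x <= e * C.
Proof.
case=> _ NZ ND.
exists (\sum_i `|N (delta_mx i 0)| + 1) => [|x e e_ge0 xe].
  by rewrite ltr_wpDl // sumr_ge0.
have N0 : N 0 = 0 by rewrite -(scale0r 0) NZ normr0 mul0r.
have {1}-> : x = \sum_i x i ord0 *: delta_mx i 0.
  by rewrite {1}[x]matrix_sum_delta; apply: eq_bigr => i _; rewrite big_ord1.
apply: (@le_trans _ _ (\sum_i e * `|N (delta_mx i 0)|)).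
  apply: (big_ind2 (fun y r => N y <= r)) => [|y r z s yr zs|i _].
  - by rewrite N0.
  - exact: le_trans (ND _ _) (lerD yr zs).
  - by rewrite NZ (le_trans (ler_wpM2l _ (ler_norm _))) // ler_wpM2r.
by rewrite -mulr_sumr ler_wpM2l ?lerDl.
Qed.

Theorem proposition13 (R : realType) (n : nat) (A : finType)
    (N : 'cV[R]_n -> R) (hN : is_norm N)
    (M : ssp R n A)
    (hproper : exists mu : policy n A, proper_policy M mu)
    (himproper : forall mu : policy n A, improper_policy M mu ->
       exists i : 'I_n, cost_to_go M mu i = +oo%E) :
  (forall i : 'I_n, opt_cost M i \is a fin_num) /\
  (forall (p : R) (hp : 0 < p < 1) (i : 'I_n),
     opt_cost (modified M hp) i \is a fin_num) /\
  (forall eps : R, 0 < eps ->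
     exists delta : R, 0 < delta /\
       forall (p : R) (hp : 0 < p < 1), 0 < p < delta ->
         N (opt_vec (modified M hp) - opt_vec M) <= eps) /\
  (exists delta0 : R, 0 < delta0 /\
     forall delta : R, 0 < delta <= delta0 ->
       forall (p : R) (hp : 0 < p < 1), 0 < p < delta ->
         forall muhat : policy n A,
           optimal_policy (modified M hp) muhat -> optimal_policy M muhat).
Proof.
have [mu0 prop0] := hproper; split; first exact: opt_cost_fin prop0 himproper.
split; first by move=> p hp i; exact: opt_cost_modified_fin.
split=> [eps eps0|].
  have [C C0 NC] := is_norm_bound hN.
  have e0 : 0 < eps / C by rewrite divr_gt0.
  have [delta d0 dP] := near_right0 (filter_forall _ (fun i =>
    opt_vec_modified_near prop0 himproper i e0)).
  exists delta; split=> // p hp /dP dp.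
  by rewrite -[eps](divfK (lt0r_neq0 C0)) NC ?ltW.
have [d0 d0_gt0 dP] := near_right0 (optimal_modified_near prop0 himproper).
exists d0; split=> // delta /andP[_ dd0] p hp /andP[p0 pd]; apply: dP.
by rewrite p0 (lt_le_trans pd).
Qed.
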